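(* Let $\mathbf{M}$ be an invertible real $n\times n$ matrix and let $\mathcal{A}\in\mathbb{R}^{m\times p\times n}$ with $m=2h$. Then $\mathcal{A}$ is $\star_{\mathbf{M}}$-symmetric if and only if every transform-domain frontal slice $\hat A^{(i)}$, $i=1,\dots,n$, is row-symmetric.
   Context: The mode-3 product $\mathcal{A}\times_3\mathbf{M}$ applies $\mathbf{M}$ to every tube $\mathcal{A}_{i,j,:}\in\mathbb{R}^n$. The transform of $\mathcal{A}$ is $\widehat{\mathcal{A}}=\mathcal{A}\times_3\mathbf{M}$, with transform-domain frontal slices $\hat A^{(i)}=\widehat{\mathcal{A}}_{:,:,i}\in\mathbb{R}^{m\times p}$. $\star_{\mathbf{M}}$-product: for $\mathcal{A}\in\mathbb{R}^{m\times p\times n}$, $\mathcal{B}\in\mathbb{R}^{p\times\ell\times n}$, $\mathcal{C}=\mathcal{A}\star_{\mathbf{M}}\mathcal{B}\in\mathbb{R}^{m\times\ell\times n}$ is the tensor with $\hat C^{(i)}=\hat A^{(i)}\hat B^{(i)}$ for all $i=1,\dots,n$. Reflection: $R$ is the $h\times h$ row-reversal (anti-identity) matrix, and $\mathcal{R}\in\mathbb{R}^{h\times h\times n}$ is the tensor all of whose transform-domain frontal slices equal $R$. $\star_{\mathbf{M}}$-symmetric: $\mathcal{A}\in\mathbb{R}^{m\times p\times n}$, $m=2h$, is $\star_{\mathbf{M}}$-symmetric if $\mathcal{A}_{1:h,:,:}=\mathcal{R}\star_{\mathbf{M}}\mathcal{A}_{h+1:m,:,:}$. Row-symmetric matrix: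 $B\in\mathbb{R}^{m\times p}$, $m=2h$, is row-symmetric if $B_{1:h,:}=R\,B_{h+1:m,:}$. *)

(* Defs.v *)
From mathcomp Require Import all_boot all_algebra.
Set Implicit Arguments.
Unset Strict Implicit.
Unset Printing Implicit Defensive.
Import GRing.Theory.
Local Open Scope ring_scope.

Definition tensor (F : fieldType) (m p n : nat) : Type :=
  {ffun 'I_m * 'I_p * 'I_n -> F}.

(* A_{i,j,:}, as a column vector *)
Definition tube (F : fieldType) (m p n : nat) (A : tensor F m p n)
    (i : 'I_m) (j : 'I_p) : 'cV[F]_n :=
  \col_k A (i, j, k).

(* A_{:,:,k} *)
Definition frontal (F : fieldType) (m p n : nat) (A : tensor F m p n)
    (k : 'I_n) : 'M[F]_(m, p) :=
  \matrix_(i, j) A (i, j, k).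

Definition of_frontal (F : fieldType) (m p n : nat)
    (S : 'I_n -> 'M[F]_(m, p)) : tensor F m p n :=
  [ffun x => S x.2 x.1.1 x.1.2].

Definition mode3 (F : fieldType) (m p n q : nat) (A : tensor F m p n)
    (M : 'M[F]_(q, n)) : tensor F m p q :=
  [ffun x => (M *m tube A x.1.1 x.1.2) x.2 0].

Definition hat_slice (F : fieldType) (m p n : nat) (M : 'M[F]_n)
    (A : tensor F m p n) (k : 'I_n) : 'M[F]_(m, p) :=
  frontal (mode3 A M) k.

(* When M is invertible, this is the unique tensor whose transform-domain
   frontal slices are the S k: see hat_sliceK and hat_slice_inj. *)
Definition of_hat_slices (F : fieldType) (m p n : nat) (M : 'M[F]_n)
    (S : 'I_n -> 'M[F]_(m, p)) : tensor F m p n :=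
  mode3 (of_frontal S) (invmx M).

Lemma mode3_mul (F : fieldType) (m p n q r : nat) (A : tensor F m p n)
    (M : 'M[F]_(q, n)) (N : 'M[F]_(r, q)) :
  mode3 (mode3 A M) N = mode3 A (N *m M).
Proof.
apply/ffunP => -[[i j] k]; rewrite !ffunE /= -mulmxA; congr ((N *m _) _ _).
by apply/colP => l; rewrite mxE ffunE.
Qed.

Lemma mode3_1 (F : fieldType) (m p n : nat) (A : tensor F m p n) :
  mode3 A 1%:M = A.
Proof. by apply/ffunP => -[[i j] k]; rewrite ffunE /= mul1mx mxE. Qed.

Lemma hat_sliceK (F : fieldType) (m p n : nat) (M : 'M[F]_n)
    (S : 'I_n -> 'M[F]_(m, p)) (k : 'I_n) :
  M \in unitmx -> hat_slice M (of_hat_slices M S) k = S k.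
Proof.
move=> uM; rewrite /hat_slice /of_hat_slices mode3_mul mulmxV // mode3_1.
by apply/matrixP => i j; rewrite mxE ffunE.
Qed.

Lemma hat_slice_inj (F : fieldType) (m p n : nat) (M : 'M[F]_n)
    (A B : tensor F m p n) :
  M \in unitmx -> (forall k, hat_slice M A k = hat_slice M B k) -> A = B.
Proof.
move=> uM eqAB; rewrite -[A]mode3_1 -[B]mode3_1 -(mulVmx uM) -!mode3_mul.
congr mode3; apply/ffunP => -[[i j] k].
by have /matrixP/(_ i j) := eqAB k; rewrite !mxE.
Qed.

Definition star_prod (F : fieldType) (m p l n : nat) (M : 'M[F]_n)
    (A : tensor F m p n) (B : tensor F p l n) : tensor F m l n :=
  of_hat_slices M (fun k => hat_slice M A k *m hat_slice M B k).

Definition reversal_mx (F : fieldType) (h : nat) : 'M[F]_h :=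
  \matrix_(i, j) (j == rev_ord i)%:R.

Definition reversal_tensor (F : fieldType) (h n : nat) (M : 'M[F]_n) :
    tensor F h h n :=
  of_hat_slices M (fun _ => reversal_mx F h).

(* A_{1:a,:,:} and A_{a+1:a+b,:,:} *)
Definition utensor (F : fieldType) (a b p n : nat) (A : tensor F (a + b) p n) :
    tensor F a p n :=
  [ffun x => A (lshift b x.1.1, x.1.2, x.2)].

Definition dtensor (F : fieldType) (a b p n : nat) (A : tensor F (a + b) p n) :
    tensor F b p n :=
  [ffun x => A (rshift a x.1.1, x.1.2, x.2)].

(* The even number of rows m = 2h is written h + h, so that the two row
   halves are the standard blocks. *)
Definition star_symmetric (F : fieldType) (h p n : nat) (M : 'M[F]_n)
    (A : tensor F (h + h) p n) : Prop :=
  utensor A = star_prod M (reversal_tensor h M) (dtensor A).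

Definition row_symmetric (F : fieldType) (h p : nat) (B : 'M[F]_(h + h, p)) :
    Prop :=
  usubmx B = reversal_mx F h *m dsubmx B.

(* Main.v *)
(** Slicing rows commutes with the mode-3 transform, which acts on each tube
    separately; and since [M] is invertible a tensor equation holds iff it holds
    on every transform-domain frontal slice, where the product is a matrix
    product. *)
Require Import Defs.
From mathcomp Require Import all_boot all_algebra reals.
Local Open Scope ring_scope.

Lemma hat_slice_utensor (F : fieldType) (a b p n : nat) (M : 'M[F]_n)
    (A : tensor F (a + b) p n) (k : 'I_n) :
  hat_slice M (utensor A) k = usubmx (hat_slice M A k).
Proof.
apply/matrixP => i j; rewrite !mxE !ffunE !mxE.
(* Both sides are now row [k] of [M] against a tube; only the tube entries remain to be matched. *)
by apply: eq_bigr => l _; rewrite !mxE ffunE.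
Qed.

Lemma hat_slice_dtensor (F : fieldType) (a b p n : nat) (M : 'M[F]_n)
    (A : tensor F (a + b) p n) (k : 'I_n) :
  hat_slice M (dtensor A) k = dsubmx (hat_slice M A k).
Proof.
apply/matrixP => i j; rewrite !mxE !ffunE !mxE.
by apply: eq_bigr => l _; rewrite !mxE ffunE.
Qed.

(** The product and the reflection tensor are both prescribed by their slices, so [hat_sliceK]
    applies twice, each time using that [M] is invertible. *)
Lemma hat_slice_reflection (F : fieldType) (h p n : nat) (M : 'M[F]_n)
    (B : tensor F h p n) (k : 'I_n) :
  M \in unitmx ->
  hat_slice M (star_prod M (reversal_tensor h M) B) k =
    reversal_mx F h *m hat_slice M B k.
Proof. by move=> uM; rewrite /star_prod !hat_sliceK. Qed.

Theorem lemma3p3 (R : realType) (h p n : nat) (M : 'M[R]_n)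
    (hM : M \in unitmx) (A : tensor R (h + h) p n) :
  star_symmetric M A <-> (forall i : 'I_n, row_symmetric (hat_slice M A i)).
Proof.
rewrite /star_symmetric /row_symmetric; split=> [symA i | symA].
  by rewrite -hat_slice_utensor symA hat_slice_reflection // hat_slice_dtensor.
(* The transform is injective, so the tensor equation may be checked slice by slice. *)
apply: (hat_slice_inj hM) => i.
by rewrite hat_slice_reflection // hat_slice_utensor hat_slice_dtensor.
Qed.
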